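(* Let $M$ be a connected $2$-dimensional manifold. Then $M$ is strongly discrete homogeneous if and only if $M$ has at most one end.
   Context: All spaces are assumed metrizable and all maps continuous. An $m$-manifold is a (metrizable) space locally homeomorphic to $\mathbb{R}^m$ (so without boundary). A family $\mathcal{D}$ of subsets of a space $X$ is discrete if each point $x\in X$ has a neighbourhood which intersects at most one set from $\mathcal{D}$. A subset $A\subset X$ is a discrete subset of $X$ if the family of singletons $\{\{a\}: a\in A\}$ is discrete in this sense (so discrete subsets are closed in $X$). A space $X$ is strongly discrete homogeneous if for any two discrete subsets $A$ and $B$ of $X$ and any bijection $f\colon A\to B$, this bijection extends to a homeomorphism of $X$ onto itself. A generalized continuum is a locally compact, $\sigma$-compact, connected, locally connected (metrizable) space; every connected manifold is one. For a generalized continuum $X$, fix compact sets $X_1,X_2,\dots\subset X$ with $X_n\subset \operatorname{int} X_{n+1}$ for all $n$ and $\bigcup_{n} X_n=X$. An end of $X$ (with respect to $\{X_n\}$) is a sequence $\{Y_n\}_{n=1}^\infty$ such that for every $n$ the set $Y_n$ is a non-empty connected component of $X\setminus X_n$ and $Y_{n+1}\subset Y_n$. The set of ends is, up to canonical identification, independent of the choice of $\{X_n\}$. A compact generalized continuum has no ends. *)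

(* Defs.v *)
From HB Require Import structures.
From mathcomp Require Import all_boot all_order all_algebra.
From mathcomp Require Import all_classical all_reals all_analysis.
From mathcomp Require Import lra.
Import Order.TTheory GRing.Theory Num.Theory.
Import numFieldNormedType.Exports.

Set Implicit Arguments.
Unset Strict Implicit.
Unset Printing Implicit Defensive.

Local Open Scope classical_set_scope.
Local Open Scope ring_scope.

Definition homeomorphism (X Y : topologicalType) (h : X -> Y) : Prop :=
  continuous h /\
  exists h' : Y -> X, [/\ continuous h', cancel h h' & cancel h' h].

(* The subspace [U] of [X] is homeomorphic to the whole space [Y]; [phi] is only
   meaningful on [U]. *)
Definition set_homeomorphic (X Y : topologicalType) (U : set X) : Prop :=
  exists (phi : X -> Y) (psi : Y -> X),
    [/\ {within U, continuous phi}, continuous psi,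
        forall y, U (psi y),
        forall x, U x -> psi (phi x) = x & cancel psi phi].

(* Metrizability is not part of this predicate: it is carried by the type of
   the space to which it is applied. *)
Definition manifold (R : realType) (m : nat) (X : topologicalType) : Prop :=
  forall x : X, exists U : set X,
    [/\ open U, U x & set_homeomorphic 'rV[R]_m U].

Definition discrete_family (X : topologicalType) (D : set (set X)) : Prop :=
  forall x : X, exists2 U : set X, nbhs x U &
    forall A B, D A -> D B -> U `&` A !=set0 -> U `&` B !=set0 -> A = B.

Definition discrete_subset (X : topologicalType) (A : set X) : Prop :=
  discrete_family [set [set a] | a in A].

(* A bijection from [A] onto [B] is given by a map [f : X -> X], whose values
   outside [A] are irrelevant. *)
Definition strongly_discrete_homogeneous (X : topologicalType) : Prop :=
  forall (A B : set X) (f : X -> X),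
    discrete_subset A -> discrete_subset B -> set_bij A B f ->
    exists2 h : X -> X, homeomorphism h & forall a, A a -> h a = f a.

Definition exhaustion (X : topologicalType) (K : nat -> set X) : Prop :=
  [/\ forall n, compact (K n),
      forall n, K n `<=` interior (K n.+1) &
      \bigcup_n K n = [set: X]].

Definition is_component (X : topologicalType) (A C : set X) : Prop :=
  exists2 x, A x & C = connected_component A x.

(* The components in the sense of [is_component] are non-empty. *)
Definition is_end (X : topologicalType) (K Y : nat -> set X) : Prop :=
  (forall n, is_component (~` K n) (Y n)) /\
  (forall n, Y n.+1 `<=` Y n).

Definition at_most_one_end (X : topologicalType) (K : nat -> set X) : Prop :=
  forall Y Z : nat -> set X, is_end K Y -> is_end K Z -> Y = Z.

(* Exhaustions exist in every connected manifold, so a statement about an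
   arbitrary exhaustion is never vacuous. Here [small x r] says that the ball of
   radius [r] about [x] is relatively compact. *)
Section ExhaustionExists.
Context (R : realType) (M : metricType R).
Implicit Types (x y : M) (r s : R).

Let small x r : Prop := exists2 C : set M, compact C & ball x r `<=` C.

Lemma small_le x r s : r <= s -> small x s -> small x r.
Proof. by move=> rs [C Cc sC]; exists C => // y /(le_ball rs)/sC. Qed.

Lemma small_near x y r s : ball x r y -> small x (r + s) -> small y s.
Proof. by move=> xy [C Cc sC]; exists C => // z yz; exact/sC/(ball_triangle xy). Qed.

Lemma manifold_small m : manifold R m M -> forall x, exists2 r, 0 < r & small x r.
Proof.
move=> hM x; have [U [oU Ux [phi [psi [cphi cpsi Upsi phiK _]]]]] := hM x.
pose B := closed_ball (phi x) 1.
have cB : compact B.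
  apply: bounded_closed_compact; last exact: closed_ball_closed.
  rewrite /B closed_ballE//; exists (`|phi x| + 1); split; first exact: num_real.
  move=> t /ltW tM y /= yB; apply: le_trans tM.
  by rewrite -lerBlDl (le_trans (lerB_dist _ _))// distrC.
have cC : compact (psi @` B).
  by apply: continuous_compact => //; exact: continuous_subspaceT.
have nB : nbhs x (U `&` phi @^-1` B).
  apply: filterI; first exact: open_nbhs_nbhs.
  rewrite continuous_open_subspace// in cphi.
  apply: (cphi x); first by rewrite inE.
  by apply: filterS (nbhsx_ballx (phi x) 1 ltr01); exact: subset_closed_ball.
have /nbhs_ballP[r /= r0 sr] := nB.
exists r => //; exists (psi @` B) => // y /sr[Uy By].
by exists (phi y) => //; exact: phiK.
Qed.

Context (hsmall : forall x, exists2 r, 0 < r & small x r).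

Let star (C : set M) : set M :=
  [set y | exists x r, [/\ C x, 0 < r, r <= 1, small x (4 * r) & ball x r y]].

Lemma scale x : exists s, [/\ 0 < s, small x s & 2 <= s \/ ~ small x (2 * s)].
Proof.
have [r r0 xr] := hsmall x.
apply: contrapT => H.
have step s : 0 < s -> small x s -> s < 2 /\ small x (2 * s).
  move=> s0 xs; split.
    by rewrite ltNge; apply/negP => s2; apply: H; exists s; split => //; left.
  by apply: contrapT => xs2; apply: H; exists s; split => //; right.
have pow n : 0 < 2 ^+ n * r /\ small x (2 ^+ n * r).
  elim: n => [|n [p0 pn]]; first by rewrite expr0 mul1r.
  rewrite exprS -mulrA; split; first by rewrite mulr_gt0.
  by have [] := step _ p0 pn.
have lt2 n : 2 ^+ n * r < 2 by have [p0 pn] := pow n; have [] := step _ p0 pn.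
have := lt2 (Num.truncn (2 / r)).+1; apply/negP; rewrite -leNgt.
rewrite -ler_pdivrMr// (le_trans (ltW (truncnS_gt (2 / r))))//.
by rewrite -natrX ler_nat ltnW// ltn_expl.
Qed.

Lemma star_compact (C : set M) : compact C ->
  exists2 C' : set M, compact C' & star C `<=` C'.
Proof.
pose F : set_system (set M) :=
  filter_from compact (fun C0 => [set C1 | C0 `<=` C1]).
have FF : Filter F.
  apply: filter_from_filter; first by exists set0; exact: compact0.
  move=> A B cA cB; exists (A `|` B); first exact: compactU.
  by move=> E; move=> sE; split => x ?; apply: sE; [left|right].
pose P (C1 : set M) x := forall r y,
  0 < r -> r <= 1 -> small x (4 * r) -> ball x r y -> C1 y.
move=> /compact_near_coveringP/(_ _ F P FF)[|C' cC' sC'].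
  move=> z _; have [s [s0 [D cD sD] hs]] := scale z.
  have e0 : 0 < s / 4 by rewrite divr_gt0.
  exists (ball z (s / 4), [set C1 | D `<=` C1]).
    by split; [exact: nbhsx_ballx|exists D].
  move=> [x C1] /= [zx DC1] r y r0 r1 xr xy; apply/DC1/sD.
  apply: (le_ball _ (ball_triangle zx xy)).
  have [s2|ns] := hs; first lra.
  have [//|lt] := leP (s / 4 + r) s.
  exfalso; apply: ns; apply: (@small_near x z (s / 4)); first exact: ball_sym.
  by apply: small_le xr; lra.
exists C' => // y [x [r [Cx r0 r1 xr xy]]].
exact: (sC' C' (@subset_refl _ _) x Cx r y).
Qed.

Lemma subset_star_interior (C : set M) : C `<=` (star C)°.
Proof.
move=> x Cx; have [r r0 xr] := hsmall x.
pose t := Num.min 1 (r / 4).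
have t0 : 0 < t by rewrite lt_min ltr01 divr_gt0.
apply/nbhs_ballP; exists t => //= y xy.
exists x, t; split=> //; first by rewrite ge_min lexx.
apply: small_le xr; have : t <= r / 4 by rewrite ge_min lexx orbT.
lra.
Qed.

Lemma star_near (x : M) : exists2 e, 0 < e &
  forall (C : set M), C `&` ball x e !=set0 -> star C x.
Proof.
have [r r0 xr] := hsmall x.
pose t := Num.min 1 (r / 5).
have t0 : 0 < t by rewrite lt_min ltr01 divr_gt0.
exists t => // C [y [Cy xy]].
exists y, t; split=> //; first by rewrite ge_min lexx.
  apply: (small_near xy); apply: small_le xr.
  by have : t <= r / 5 by [rewrite ge_min lexx orbT]; lra.
exact: ball_sym.
Qed.

Lemma exhaustion_small : connected [set: M] -> exists K : nat -> set M, exhaustion K.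
Proof.
move=> conn.
have [[x0 _]|/set0P/negP/negPn/eqP M0] := pselect ([set: M] !=set0); last first.
  exists (fun=> set0); split => [n|n x //|].
    exact: compact0.
  by rewrite bigcup0 ?M0.
have /choice[next hnext] : forall C : set M, exists C' : set M,
    compact C -> compact C' /\ star C `<=` C'.
  move=> C; have [cC|nC] := pselect (compact C); last by exists set0.
  by have [C' ? ?] := star_compact cC; exists C'.
pose K n := iter n next [set x0].
have cK n : compact (K n).
  by elim: n => [|n /hnext[]]//; exact: compact_set1.
have sK n : star (K n) `<=` K n.+1 by have [] := hnext _ (cK n).
have iK n : K n `<=` (K n.+1)°.
  by move=> x /subset_star_interior; apply: filterS => y /sK.
exists K; split => //.
apply: conn.
- by exists x0, 0%N.
- exists (\bigcup_n K n); last by rewrite setTI.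
  rewrite openE => x [n _ /iK]; apply: filterS => y Ky.
  by exists n.+1.
- exists (\bigcup_n K n); last by rewrite setTI.
  move=> x clx; have [e e0 he] := star_near x.
  have [y [[n _ Ky] xy]] := clx _ (nbhsx_ballx _ _ e0).
  by exists n.+1 => //; apply/sK/he; exists y.
Qed.

End ExhaustionExists.

Lemma exhaustion_exists (R : realType) (m : nat) (M : metricType R) :
  connected [set: M] -> manifold R m M ->
  exists K : nat -> set M, exhaustion K.
Proof. by move=> conn /manifold_small hM; exact: exhaustion_small. Qed.

(* Main.v *)
(** If [M] has two ends, choose sequences converging to each of them and a bijection
    of their union exchanging the even terms and fixing the odd ones: a homeomorphism
    extending it would send one end to both.

    Conversely, if there is at most one end, every compact set lies in a compact set
    with connected complement. An open connected set [W] of a surface stays connected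
    when a closed discrete set is removed, so finitely many points of [W] can be moved
    to prescribed places one after the other, by homeomorphisms with compact support in
    [W] fixing any other given closed discrete set. For disjoint [A] and [f(A)] take
    compact sets [L_0, L_1, ...] with connected complements, exhausting [M], and
    homeomorphisms [g_n] with support in [L_(n+2) - L_n], where [g_n] sends [a] to
    [f(a)] for the finitely many [a] such that [{a, f(a)}] meets [L_(n+1)] but not [L_n]
    and fixes all other points of [A] and [f(A)]; [L_(n+2)] is chosen after [g_n]. The
    [g_n] with [n] even have disjoint, locally finite supports and glue to a
    homeomorphism, and so do those with [n] odd; the composite of the two extends [f].
    The general case factors through a third discrete set disjoint from both. *)
Require Import Defs.
From HB Require Import structures.
From mathcomp Require Import all_boot all_order all_algebra.
From mathcomp Require Import all_classical all_reals all_analysis.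
From mathcomp Require Import lra.
Import Order.TTheory GRing.Theory Num.Theory.
Import numFieldNormedType.Exports.

Set Implicit Arguments.
Unset Strict Implicit.
Unset Printing Implicit Defensive.

Local Open Scope classical_set_scope.
Local Open Scope ring_scope.

(** * Normed spaces *)

Lemma lipschitz_continuous (R : realType) (V W : normedModType R)
    (f : V -> W) (k : R) :
  0 < k -> (forall x y, `|f x - f y| <= k * `|x - y|) -> continuous f.
Proof.
move=> k0 fk x; apply/cvgrPdist_lt => e e0.
near=> y; rewrite (le_lt_trans (fk _ _))// mulrC -ltr_pdivlMr//.
near: y; apply: cvgr_dist_lt; [exact: cvg_id|by rewrite divr_gt0].
Unshelve. all: by end_near. Qed.

(* The bump displacement [x + max 0 (rho - |x - p|) w], [w = (q - p) / rho], is a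
   Lipschitz perturbation of the identity with constant [|w| < 1]. *)
Lemma bump_homeomorphism (R : realType) (V : normedModType R) (p q : V)
    (rho : R) : `|q - p| < rho ->
  exists F : V -> V, [/\ homeomorphism F, F p = q &
    forall x, rho <= `|x - p| -> F x = x].
Proof.
move=> qp; have r0 : 0 < rho by rewrite (le_lt_trans _ qp).
pose w := rho^-1 *: (q - p).
have w1 : `|w| < 1.
  by rewrite normrZ gtr0_norm ?invr_gt0// mulrC ltr_pdivrMr// mul1r.
pose m (x : V) : R := Num.max 0 (rho - `|x - p|).
have mL x y : `|m x - m y| <= `|x - y|.
  have /ler_normlP[h1 h2] := ler_dist_dist (x - p) (y - p).
  have : x - p - (y - p) = x - y by rewrite opprB addrA subrK.
  move=> h3; rewrite h3 in h1 h2.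
  have h4 := normr_ge0 (x - y).
  by rewrite ler_norml /m !maxEle; case: ifPn; case: ifPn; rewrite -?ltNge; lra.
pose F x := x + m x *: w.
(* This lower bound gives both the injectivity of [F] and a Lipschitz constant for its inverse. *)
have FL x y : (1 - `|w|) * `|x - y| <= `|F x - F y|.
  rewrite /F opprD addrACA -scalerBl.
  rewrite mulrBl mul1r (le_trans _ (lerB_normD _ _))// lerB// normrZ mulrC.
  by rewrite ler_wpM2l.
have FU x y : `|F x - F y| <= 2 * `|x - y|.
  rewrite /F opprD addrACA -scalerBl.
  rewrite (le_trans (ler_normD _ _))// normrZ.
  have : `|m x - m y| * `|w| <= `|x - y| * 1 by rewrite ler_pM// ltW.
  lra.
have Finj x y : F x = F y -> x = y.
  move=> Fxy; have := FL x y; rewrite Fxy subrr normr0 => h.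
  apply/eqP; rewrite -subr_eq0 -normr_le0.
  by rewrite -(pmulr_rle0 _ (_ : 0 < 1 - `|w|))// subr_gt0.
have mc : continuous m.
  by apply: (@lipschitz_continuous _ _ R^o _ 1) => // x y; rewrite mul1r; exact: mL.
(* [F] moves points along [w] only, so a preimage is sought as [y - s *: w]. This asks for
   [s = m (y - s *: w)], solved by the intermediate value theorem since [m] takes values in
   [[0, rho]]. *)
have Fsurj y : exists x, F x = y.
  pose phi (s : R) := s - m (y - s *: w).
  have cphi : continuous phi.
    move=> s; apply: cvgB; first exact: cvg_id.
    apply: (@continuous_comp _ _ _ (fun s : R => y - s *: w) m); last exact: mc.
    by apply: cvgB; [exact: cvg_cst|apply: cvgZr_tmp; exact: cvg_id].
  have [| |c _ phic] := @IVT R phi 0 rho 0 (ltW r0).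
  - exact: continuous_subspaceT.
  - rewrite ge_min le_max /phi sub0r oppr_le0 subr_ge0.
    rewrite [0 <= m _]le_max lexx/= [m _ <= _]ge_max (ltW r0)/=.
    by rewrite gerBl normr_ge0 orbT.
  exists (y - c *: w); rewrite /F.
  by move/eqP: phic; rewrite subr_eq0 => /eqP <-; rewrite subrK.
have /choice[F' FK] := Fsurj.
have F'K : cancel F F' by move=> x; apply: Finj; rewrite FK.
exists F; split.
- split; first exact: lipschitz_continuous FU.
  exists F'; split => //.
  apply: (@lipschitz_continuous _ _ _ _ (1 - `|w|)^-1).
    by rewrite invr_gt0 subr_gt0.
  move=> x y; rewrite -{2}(FK x) -{2}(FK y) mulrC ler_pdivlMr ?subr_gt0//.
  by rewrite mulrC.
- rewrite /F /m subrr normr0 subr0 max_r ?(ltW r0)// /w scalerA.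
  by rewrite divff ?gt_eqF// scale1r addrC subrK.
- by move=> x xp; rewrite /F /m max_l ?subr_le0// scale0r addr0.
Qed.

Lemma convex_connected (R : realType) (V : normedModType R) (C : set V) :
  (forall x y t, C x -> C y -> 0 <= t <= 1 -> C (x + t *: (y - x))) ->
  connected C.
Proof.
move=> cC; have [->|/set0P[x Cx]] := eqVneq C set0; first exact: connected0.
pose s y (t : R) := x + t *: (y - x).
have -> : C = \bigcup_(y in C) (s y @` `[0, 1]).
  apply/seteqP; split => [y Cy|z [y Cy [t]]].
    exists y => //; exists 1; rewrite /= ?in_itv/= ?ler01 ?lexx//.
    by rewrite /s scale1r addrC subrK.
  by rewrite /= in_itv/= => t01 <-; exact: cC.
apply: bigcup_connected.
  exists x => y Cy; exists 0; rewrite /= ?in_itv/= ?ler01 ?lexx//.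
  by rewrite /s scale0r addr0.
move=> y Cy; apply: connected_continuous_connected.
  exact: segment_connected.
apply: continuous_subspaceT => t; apply: cvgD; first exact: cvg_cst.
by apply: cvgZr_tmp; exact: cvg_id.
Qed.

Lemma ball_convex (R : realType) (V : normedModType R) (p x y : V) (r t : R) :
  ball p r x -> ball p r y -> 0 <= t <= 1 -> ball p r (x + t *: (y - x)).
Proof.
rewrite -ball_normE /ball_/= => px py /andP[t0 t1].
have -> : p - (x + t *: (y - x)) = (1 - t) *: (p - x) + t *: (p - y).
  have -> : p - y = (p - x) - (y - x) by rewrite opprB addrA subrK.
  rewrite scalerBl scale1r [t *: (_ - (y - x))]scalerBr opprD addrA.
  by rewrite [RHS]addrA subrK.
rewrite (le_lt_trans (ler_normD _ _))// !normrZ ger0_norm ?subr_ge0// ger0_norm//.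
(* Strictness comes from the term in [t], hence the separate case [t = 0]. *)
have [->|tn] := eqVneq t 0; first by rewrite subr0 mul0r mul1r addr0.
have tp : 0 < t by rewrite lt_neqAle eq_sym tn.
have h1 : (1 - t) * `|p - x| <= (1 - t) * r by rewrite ler_wpM2l ?subr_ge0// ltW.
have h2 : t * `|p - y| < t * r by rewrite ltr_pM2l.
lra.
Qed.

Lemma ball_connected (R : realType) (V : normedModType R) (p : V) (r : R) :
  connected (ball p r).
Proof. by apply: convex_connected => x y t; exact: ball_convex. Qed.

(* In dimension 2 the punctured (square) ball is covered by four convex halves,
   consecutive ones of which meet. *)
Lemma punctured_ball_connected (R : realType) (p : 'rV[R]_2) (r : R) :
  connected (ball p r `\ p).
Proof.
have [r0|r0] := leP r 0.
  suff -> : ball p r `\ p = set0 by exact: connected0.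
  by rewrite -subset0 => x [[/lt_geF]]; rewrite r0.
pose H (i : 'I_2) (e : R) := ball p r `&` [set x | 0 < e * (x ord0 i - p ord0 i)].
have cH i e : connected (H i e).
  apply: convex_connected => x y t [bx hx] [by_ hy] t01; split => /=.
    exact: ball_convex.
  case/andP: t01 => t0 t1; rewrite !mxE.
  set a := x _ _; set b := y _ _; set c := p _ _.
  have [->|tn] := eqVneq t 0; first by rewrite mul0r addr0.
  have tp : 0 < t by rewrite lt_neqAle eq_sym tn.
  have h1 : 0 <= (1 - t) * (e * (a - c)) by rewrite mulr_ge0 ?subr_ge0// ltW.
  have h2 : 0 < t * (e * (b - c)) by rewrite mulr_gt0.
  lra.
have pt (u v : R) : `|u| < r -> `|v| < r ->
    ball p r (p + \row_j (if j == ord0 then u else v)).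
  move=> ur vr; split => // i j; rewrite ord1 -ball_normE /ball_/= !mxE.
  by rewrite opprD addrA subrr sub0r normrN; case: ifP.
(* The norm is the maximum over the coordinates, so offsets of size [r / 2] in both directions stay
   in the ball; the signs [u] and [v] put the point in both halves. *)
have meet (u v : R) : `|u| = 1 -> `|v| = 1 -> H ord0 u `&` H ord_max v !=set0.
  move=> u1 v1; have r2 : `|r / 2| < r by rewrite ger0_norm; lra.
  exists (p + \row_j (if j == ord0 then u * (r / 2) else v * (r / 2))).
  have b : ball p r (p + \row_j (if j == ord0 then u * (r / 2) else v * (r / 2))).
    by apply: pt; rewrite normrM ?u1 ?v1 mul1r.
  have sq (x : R) : `|x| = 1 -> x * x = 1.
    by move=> x1; rewrite -expr2 -real_normK ?num_real// x1 expr1n.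
  split; split => //=; rewrite !mxE/= [p _ _ + _]addrC addrK mulrA sq//; lra.
have -> : ball p r `\ p =
    ((H ord0 1 `|` H ord_max 1) `|` H ord0 (-1)) `|` H ord_max (-1).
  apply/seteqP; split => [x [bx xp]|x]; last first.
    have no i e : ~ H i e p by move=> [_ /=]; rewrite subrr mulr0 ltxx.
    by case=> [[[]|]|] h; (split; first by case: h);
      move=> xp; apply: (no _ _ (eq_ind _ _ h _ xp)).
  have [i] : exists i, x ord0 i != p ord0 i.
    apply: contrapT => /forallNP h; apply: xp; apply/rowP => i.
    by have /negP := h i; rewrite negbK => /eqP.
  rewrite -subr_eq0 neq_lt => ix.
  have hi : H i 1 x \/ H i (-1) x.
    by case/orP: ix => ?; [right|left]; split => //=; lra.
  have [|] : i = ord0 \/ i = ord_max.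
    by case: i {ix hi} => -[|[|//]] ?; [left|right]; exact: val_inj.
  - by move=> ei; rewrite ei in hi; case: hi => ?; [left; left; left|left; right].
  - by move=> ei; rewrite ei in hi; case: hi => ?; [left; left; right|right].
have n1 : `|1 : R| = 1 by rewrite normr1.
have n2 : `|-1 : R| = 1 by rewrite normrN1.
apply: connectedU => //.
  have [z [z1 z2]] := meet _ _ n1 n2.
  by exists z; split => //; left; left.
apply: connectedU => //.
  have [z [z1 z2]] := meet _ _ n2 n1.
  by exists z; split => //; right.
by apply: connectedU => //; exact: meet.
Qed.

(** * Moving points in a surface *)

Lemma near_eq_continuous (X Y : topologicalType) (f g : X -> Y) (x : X) :
  (\forall y \near x, f y = g y) ->
  {for x, continuous g} -> {for x, continuous f}.
Proof.
move=> fg cg A; rewrite (nbhs_singleton fg) => /cg; rewrite !nbhs_simpl/= => gA.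
by near=> y; rewrite /= (near fg y)//; near: y.
Unshelve. all: by end_near. Qed.

(** The part of [W] in [E] and the part outside [E] are both open. *)
Lemma connected_locally_constant (X : topologicalType) (W E : set X) :
  open W -> connected W ->
  (forall x, W x -> \forall y \near x, W y -> (E x <-> E y)) ->
  forall x, W x -> E x -> W `<=` E.
Proof.
move=> oW cW Eloc x Wx Ex.
have oF (F : set X) : (forall x, W x -> F x -> \forall y \near x, W y -> F y) ->
    open (W `&` F).
  move=> hF; rewrite openE => y [Wy Fy].
  have nW : nbhs y W by exact: open_nbhs_nbhs.
  rewrite /interior; apply: filterS2 nW (hF _ Wy Fy) => z Wz h.
  by split => //; exact: h.
suff <- : W `&` E = W by move=> y [].
apply: cW; first by exists x.
- exists (W `&` E); last by rewrite setIA setIid.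
  by apply: oF => y /Eloc h Ey; apply: filterS h => z h /h[h1 _]; exact: h1.
- exists (~` (W `&` ~` E)).
    apply: open_closedC; apply: oF => y /Eloc h Ey; apply: filterS h => z h.
    by move=> /h[_ h1] /h1.
  apply/seteqP; split => y [Wy h]; split => //.
    by move=> [_]; exact.
  by apply: contrapT => Ey; exact: h.
Qed.

(** * Homeomorphisms with compact support *)

Lemma homeomorphism_id (X : topologicalType) : homeomorphism (@id X).
Proof. by split; [move=> x; exact: cvg_id|exists id; split => // x; exact: cvg_id]. Qed.

Lemma homeomorphism_comp (X Y Z : topologicalType) (f : X -> Y) (g : Y -> Z) :
  homeomorphism f -> homeomorphism g -> homeomorphism (g \o f).
Proof.
move=> [cf [f' [cf' fK f'K]]] [cg [g' [cg' gK g'K]]]; split.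
  by move=> x; apply: continuous_comp; [exact: cf|exact: cg].
exists (f' \o g'); split; last 2 first.
- exact: can_comp.
- exact: can_comp.
by move=> x; apply: continuous_comp; [exact: cg'|exact: cf'].
Qed.

Lemma homeomorphism_inj (X Y : topologicalType) (f : X -> Y) :
  homeomorphism f -> injective f.
Proof. by move=> [_ [f' [_ /can_inj]]]. Qed.

(** [S] may be any compact set containing the moved points, not just their closure, so supports of
    composites are handled by plain unions. *)
Definition supported (X : topologicalType) (W : set X) (g : X -> X) : Prop :=
  exists2 S : set X, compact S & S `<=` W /\ forall x, ~ S x -> g x = x.

Lemma supported_out (X : topologicalType) (W : set X) (g : X -> X) x :
  supported W g -> ~ W x -> g x = x.
Proof. by move=> [S _ [SW gS]] Wx; apply: gS => /SW. Qed.

Lemma supported_sub (X : topologicalType) (W W' : set X) (g : X -> X) :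
  W `<=` W' -> supported W g -> supported W' g.
Proof.
by move=> WW [S cS [SW gS]]; exists S => //; split => //; exact: subset_trans WW.
Qed.

Lemma supported_id (X : topologicalType) (W : set X) : supported W id.
Proof. by exists set0; [exact: compact0|split]. Qed.

Lemma supported_comp (X : topologicalType) (W : set X) (f g : X -> X) :
  supported W f -> supported W g -> supported W (g \o f).
Proof.
move=> [S cS [SW fS]] [T cT [TW gT]]; exists (S `|` T); first exact: compactU.
split; first by rewrite subUset.
by move=> x; rewrite not_orE => -[Sx Tx] /=; rewrite fS// gT.
Qed.

Definition movable (X : topologicalType) (W : set X) (x y : X) : Prop :=
  exists g : X -> X, [/\ homeomorphism g, supported W g & g x = y].

Lemma movable_trans (X : topologicalType) (W : set X) (x y z : X) :
  movable W x y -> movable W y z -> movable W x z.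
Proof.
move=> [f [hf sf <-]] [g [hg sg <-]]; exists (g \o f).
by split; [exact: homeomorphism_comp|exact: supported_comp|].
Qed.

Lemma movable_sym (X : topologicalType) (W : set X) (x y : X) :
  movable W x y -> movable W y x.
Proof.
move=> [f [[cf [f' [cf' fK f'K]]] [S cS [SW fS]] <-]]; exists f'; split => //.
- by split => //; exists f.
- by exists S => //; split => // z /fS fz; rewrite -[in LHS]fz fK.
Qed.

(** Since [x] ranges over the whole space, this means closed and discrete; in a T1 space it is
    [discrete_subset] in a form suited to filters. *)
Definition locally_sparse (X : topologicalType) (P : set X) : Prop :=
  forall x, \forall y \near x, P y -> y = x.

Lemma locally_sparse_sub (X : topologicalType) (P Q : set X) :
  P `<=` Q -> locally_sparse Q -> locally_sparse P.
Proof. by move=> PQ hQ x; apply: filterS (hQ x) => y h /PQ. Qed.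

Lemma locally_sparseU (X : topologicalType) (P Q : set X) :
  locally_sparse P -> locally_sparse Q -> locally_sparse (P `|` Q).
Proof.
by move=> hP hQ x; apply: filterS2 (hP x) (hQ x) => y h1 h2 [/h1|/h2].
Qed.

Lemma locally_sparse_closed (X : topologicalType) (P : set X) :
  locally_sparse P -> closed P.
Proof.
move=> hP; rewrite -(setCK P); apply: open_closedC; rewrite openE => x Px.
by apply: filterS (hP x) => y h Py; apply: Px; rewrite -(h Py).
Qed.

(** A neighbourhood of [x] meeting at most one singleton contains at most one point [z] of [A]; if
    [z] is not [x], the T1 axiom removes it. *)
Lemma discrete_subset_sparse (X : topologicalType) (A : set X) :
  accessible_space X -> discrete_subset A -> locally_sparse A.
Proof.
move=> T1 dA x; have [U nU hU] := dA x.
have [[z [zx [Az Uz]]]|nz] := pselect (exists z, z <> x /\ A z /\ U z).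
  have nz : nbhs x (~` [set z]).
    apply: open_nbhs_nbhs; split => [|/esym//].
    by apply: closed_openC; exact: accessible_closed_set1.
  apply: filterS2 nU nz => y Uy yz Ay; exfalso; apply: yz.
  have /= : [set y] = [set z].
    by apply: hU; [exists y|exists z|exists y|exists z].
  by move/seteqP => [/(_ y erefl)].
apply: filterS nU => y Uy Ay; apply: contrapT => yx; apply: nz.
by exists y.
Qed.

Lemma sparse_discrete_subset (X : topologicalType) (A : set X) :
  locally_sparse A -> discrete_subset A.
Proof.
move=> hA x; exists [set y | A y -> y = x]; first exact: hA.
move=> _ _ [a Aa <-] [b Ab <-] [y [/= ha ya]] [z [/= hb zb]].
by subst y z; rewrite ha// hb.
Qed.

Lemma finite_sparse (X : topologicalType) (A : set X) :
  accessible_space X -> finite_set A -> locally_sparse A.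
Proof.
move=> /accessible_finite_set_closed T1 fA x.
have nA : nbhs x (~` (A `\ x)).
  apply: open_nbhs_nbhs; split; last by move=> [_]; exact.
  by apply: closed_openC; apply: T1; exact: finite_setD.
apply: filterS nA => y h Ay; apply: contrapT => yx; exact: h.
Qed.

Lemma compact_sparse_finite (X : topologicalType) (A Q : set X) :
  compact Q -> locally_sparse A -> finite_set (A `&` Q).
Proof.
move=> cQ hA.
(* A property holds near [F] when it holds for all sets containing some fixed finite set; the
   near-covering form of compactness then replaces finite subcovers. *)
pose F : set_system (set X) := filter_from finite_set (fun D => [set E | D `<=` E]).
have FF : Filter F.
  apply: filter_from_filter; first by exists set0.
  move=> C D fC fD; exists (C `|` D); first by rewrite finite_setU.
  by move=> E sE; split => x ?; apply: sE; [left|right].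
have /compact_near_coveringP/(_ _ F (fun E x => A x -> E x) FF) := cQ.
case=> [x _|D fD /(_ D (@subset_refl _ _)) sD].
  exists ([set y | A y -> y = x], [set E : set X | E x]) => /=.
    split; first exact: hA.
    by exists [set x]; [exact: finite_set1|move=> E; apply].
  by move=> [y E] /= [h Ex] /h ->.
by apply: sub_finite_set fD => x [Ax /sD]; exact.
Qed.

Lemma closed_ball_compact (R : realType) n (p : 'rV[R]_n) (r : R) :
  0 < r -> compact (closed_ball p r).
Proof.
move=> r0; apply: bounded_closed_compact; last exact: closed_ball_closed.
rewrite closed_ballE//; exists (`|p| + r); split; first exact: num_real.
move=> t /ltW tM y /= yB; apply: le_trans tM.
by rewrite -lerBlDl (le_trans (lerB_dist _ _))// distrC.
Qed.

(** * Discs in a surface and homeomorphisms moving points *)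

Section Surface.
Context (R : realType) (M : metricType R) (hman : manifold R 2 M).
Implicit Types (x y : M) (W : set M).

Lemma surface_chart x W : open W -> W x ->
  exists (U : set M) (phi : M -> 'rV[R]_2) (psi : 'rV[R]_2 -> M),
    ([/\ open U, U x, {in U, continuous phi} & continuous psi] /\
     [/\ forall p, U (psi p), forall y, U y -> psi (phi y) = y & cancel psi phi]) /\
    exists2 r, 0 < r & forall p, closed_ball (phi x) r p -> W (psi p).
Proof.
move=> oW Wx; have [U [oU Ux [phi [psi [cphi cpsi Upsi phiK psiK]]]]] := hman x.
exists U, phi, psi; split.
  by rewrite continuous_open_subspace// in cphi.
have : nbhs (phi x) (psi @^-1` W).
  by apply: cpsi; rewrite phiK//; exact: open_nbhs_nbhs.
move=> /nbhs_closedballP[r h]; exists r%:num => // p hp; exact: h.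
Qed.

(** [N] is the image of a small ball under a chart. Dimension 2 enters through the connectedness of
    the punctured disc. *)
Lemma surface_disc x W : open W -> W x ->
  exists N, [/\ open N, N x & N `<=` W] /\
    [/\ connected N, connected (N `\ x) & N `\ x !=set0].
Proof.
move=> oW Wx; have [U [phi [psi [[[oU Ux cphi cpsi] [Upsi phiK psiK]] [r r0 hr]]]]] :=
  surface_chart oW Wx.
have NE : U `&` phi @^-1` ball (phi x) r = psi @` ball (phi x) r.
  apply/seteqP; split => [y [Uy by_]|_ [p bp <-]]; first by exists (phi y) => //; exact: phiK.
  by split; [exact: Upsi|rewrite /= psiK].
have NE' : (U `&` phi @^-1` ball (phi x) r) `\ x = psi @` (ball (phi x) r `\ phi x).
  rewrite NE; apply/seteqP; split => [_ [[p bp <-]] px|_ [p [bp px] <-]].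
    by exists p => //; split => // pE; apply: px; rewrite /= pE phiK.
  by split; [exists p|move=> /= pE; apply: px; rewrite /= -(psiK p) pE].
exists (U `&` phi @^-1` ball (phi x) r); split; split.
- by move/(continuous_inP _ oU): cphi; apply; exact: ball_open.
- by split => //; exact: ballxx.
- rewrite NE => _ [p bp <-]; apply: hr; exact: subset_closed_ball.
- rewrite NE; apply: connected_continuous_connected; first exact: ball_connected.
  exact: continuous_subspaceT.
- rewrite NE'; apply: connected_continuous_connected.
    exact: punctured_ball_connected.
  exact: continuous_subspaceT.
- rewrite NE'; exists (psi (phi x + \row_j (r / 2))).
  exists (phi x + \row_j (r / 2)) => //; split.
    split => // i j; rewrite ord1 -ball_normE /ball_/= !mxE.
    by rewrite opprD addrA subrr sub0r normrN ger0_norm; lra.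
  by move=> /rowP/(_ ord0); rewrite !mxE; lra.
Qed.

(** For a non-empty relatively clopen part [B] of the complement, filling the complement near a
    point is a locally constant property on [W]: a small disc deprived of [P] is connected, so it
    lies in [B] or misses [B]. *)
Lemma sparse_complement_connected W (P : set M) :
  open W -> connected W -> locally_sparse P -> connected (W `\` P).
Proof.
move=> oW cW hP B [b Bb] [C oC BC] [D cD BD].
have WPB y : B y -> W y /\ ~ P y by rewrite BC => -[].
(* [N] meets [P] at most in [x]; the last clause says that [N] minus [P] is dense in [N]. *)
have disc x : W x -> exists N, [/\ open N, N x, N `<=` W &
    connected (N `\` P) /\ forall z, N z -> nbhs z `<=` [set V | (V `&` (N `\` P)) !=set0]].
  move=> Wx; have : nbhs x [set y | P y -> y = x] by exact: hP.
  rewrite nbhsE => -[V [oV Vx] hV].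
  have [N [[oN Nx NV] [cN cNx _]]] := @surface_disc x (W `&` V) (openI oW oV) (conj Wx Vx).
  exists N; split => //; first by move=> y /NV[].
  split.
    have [Px|Px] := pselect (P x).
      suff -> : N `\` P = N `\ x by [].
      apply/seteqP; split => y [Ny h]; split => //; first by move=> /= yx; rewrite yx in h.
      by move=> Py; apply: h; apply: hV => //; exact: (NV y Ny).2.
    suff -> : N `\` P = N by [].
    apply/seteqP; split => [y []//|y Ny]; split => // Py.
    by apply: Px; rewrite -(hV y (NV y Ny).2 Py).
  move=> z Nz V' V'z.
  have [Pz|Pz] := pselect (P z); last by exists z; split => //; exact: nbhs_singleton.
  have : nbhs z (V' `&` N) by apply: filterI => //; exact: open_nbhs_nbhs.
  rewrite nbhsE => -[Z [oZ Zz] hZ].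
  have [N' [[oN' N'z N'Z] [_ _ [t [N't tz]]]]] := surface_disc oZ Zz.
  have [V't Nt] := hZ _ (N'Z _ N't).
  exists t; split => //; split => // Pt; apply: tz => /=.
  by rewrite (hV _ (NV _ Nt).2 Pt) (hV _ (NV _ Nz).2 Pz).
(* Unlike [B], the property [E] makes sense at the points of [P], so the connectedness of [W]
   applies to it. *)
pose E x := nbhs x [set y | ~ P y -> B y].
have WE : W `<=` E.
  have [Wb Pb] := WPB _ Bb.
  apply: (connected_locally_constant oW cW _ Wb); last first.
    have Cb : C b by move: Bb; rewrite BC => -[].
    have := open_nbhs_nbhs (conj (openI oW oC) (conj Wb Cb)).
    by apply: filterS => y [Wy Cy] Py; rewrite BC.
  move=> x Wx; have [N [oN Nx NW [cN dN]]] := disc x Wx.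
  (* The right-hand side does not mention [z], so [E] is constant on [N]. *)
  have key z : N z -> E z <-> N `\` P `<=` B.
    move=> Nz; split => [/(dN z Nz)[t [/= Et [Nt Pt]]]|NB].
      have BNB : B `&` (N `\` P) = N `\` P.
        apply: cN; first by exists t; split => //; exact: Et.
          exists C => //; rewrite BC; apply/seteqP; split => y.
            by move=> [[_ ?] ?].
          by move=> [[Ny Py] Cy]; split => //; split => //; split => //; exact: NW.
        exists D => //; rewrite BD; apply/seteqP; split => y.
          by move=> [[_ ?] ?].
        by move=> [[Ny Py] Cy]; split => //; split => //; split => //; exact: NW.
      by rewrite -BNB => y [].
    have := open_nbhs_nbhs (conj oN Nz).
    by apply: filterS => y Ny Py; exact: NB.
  have := open_nbhs_nbhs (conj oN Nx).
  by apply: filterS => y Ny _; rewrite !key.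
apply/seteqP; split => [y /WPB//|y [Wy Py]].
exact: (nbhs_singleton (WE _ Wy) Py).
Qed.

(* A homeomorphism of the plane supported in a compact set extends by the identity
   outside the chart, since its support is closed in [M]. *)
Lemma movable_near x W : open W -> W x -> \forall y \near x, movable W x y.
Proof.
move=> oW Wx; have [U [phi [psi [[[oU Ux cphi cpsi] [Upsi phiK psiK]] [r r0 hr]]]]] :=
  surface_chart oW Wx.
pose S := psi @` closed_ball (phi x) r.
have cS : compact S.
  apply: continuous_compact; first exact: continuous_subspaceT.
  exact: closed_ball_compact.
pose ext (F : 'rV[R]_2 -> 'rV[R]_2) z := if pselect (U z) then psi (F (phi z)) else z.
have extU F z : U z -> ext F z = psi (F (phi z)) by rewrite /ext; case: pselect.
have extN F z : ~ U z -> ext F z = z by rewrite /ext; case: pselect.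
have extS F : (forall p, ~ closed_ball (phi x) r p -> F p = p) ->
    forall z, ~ S z -> ext F z = z.
  move=> hF z Sz; rewrite /ext; case: pselect => // Uz; rewrite hF; first exact: phiK.
  by move=> h; apply: Sz; exists (phi z) => //; exact: phiK.
have extc F : (forall p, ~ closed_ball (phi x) r p -> F p = p) -> continuous F ->
    continuous (ext F).
  move=> hF cF z; have [Uz|Uz] := pselect (U z).
    apply: (@near_eq_continuous _ _ _ (psi \o (F \o phi))).
      by apply: filterS (open_nbhs_nbhs (conj oU Uz)) => y /extU ->.
    apply: continuous_comp; last exact: cpsi.
    by apply: continuous_comp; [apply: cphi; rewrite inE|exact: cF].
  apply: (@near_eq_continuous _ _ _ id); last exact: cvg_id.
  have Sz : (~` S) z by move=> [p _ pz]; apply: Uz; rewrite -pz.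
  have oS : open (~` S).
    by apply: closed_openC; apply: compact_closed => //; exact: metric_hausdorff.
  by apply: filterS (open_nbhs_nbhs (conj oS Sz)) => y; exact: extS.
have oN : open (U `&` phi @^-1` ball (phi x) r).
  by move/(continuous_inP _ oU): cphi; apply; exact: ball_open.
have := open_nbhs_nbhs (conj oN (conj Ux (ballxx _ r0))).
apply: filterS => y [Uy]; rewrite /= -ball_normE /ball_/= distrC => /bump_homeomorphism.
move=> [F [[cF [F' [cF' FK F'K]]] Fx Fout]].
have Fo p : ~ closed_ball (phi x) r p -> F p = p.
  rewrite closed_ballE// /closed_ball_/= => /negP; rewrite -ltNge distrC => /ltW.
  exact: Fout.
have F'o p : ~ closed_ball (phi x) r p -> F' p = p.
  by move=> /Fo h; rewrite -[in LHS]h FK.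
exists (ext F); split.
- split; first exact: extc.
  have K G G' : cancel G G' -> cancel (ext G) (ext G').
    move=> GK z; have [Uz|Uz] := pselect (U z).
      by rewrite [ext G z]extU// extU// psiK GK phiK.
    by rewrite (extN G)// extN.
  by exists (ext F'); split; [exact: extc|exact: K|exact: K].
- exists S => //; split; first by move=> _ [p /hr ? <-].
  exact: extS.
- by rewrite extU// Fx phiK.
Qed.

(** [movable W] is an equivalence relation whose classes in [W] are open by [movable_near]. *)
Lemma connected_movable W x y :
  open W -> connected W -> W x -> W y -> movable W x y.
Proof.
move=> oW cW Wx; apply: (connected_locally_constant oW cW _ Wx); last first.
  exists id; split => //; first exact: homeomorphism_id.
  exact: supported_id.
move=> z Wz; apply: filterS (movable_near oW Wz) => t zt _; split.
  by move/movable_trans; exact.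
by move/movable_trans; apply; exact: movable_sym.
Qed.

(** Induction on [s]: the tail is moved inside [W] without [a] and [f a], then [a] is moved inside
    [W] without all other sources and targets. Removing finitely many points keeps [W] open and
    connected. *)
Lemma connected_movable_finite W (f : M -> M) (s : seq M) :
  open W -> connected W -> uniq (s ++ map f s) ->
  (forall x, x \in s ++ map f s -> W x) ->
  exists g : M -> M, [/\ homeomorphism g, supported W g &
    forall x, x \in s -> g x = f x].
Proof.
elim: s W => [|a s IH] W oW cW.
  by exists id; split => //; [exact: homeomorphism_id|exact: supported_id].
rewrite /= mem_cat inE => /andP[]; rewrite !negb_or => /and3P[as_ afa afs].
have pE : perm_eq (s ++ f a :: map f s) (f a :: (s ++ map f s)).
  by apply/permPl; exact: (perm_catCA s [:: f a] (map f s)).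
rewrite (perm_uniq pE) /= => /andP[fas us] hW.
have hW' x : x \in s ++ map f s -> W x.
  by move=> xs; apply: hW; rewrite inE (perm_mem pE) inE xs !orbT.
have Wa : W a by apply: hW; rewrite inE eqxx.
have Wfa : W (f a) by apply: hW; rewrite inE (perm_mem pE) inE eqxx orbT.
have oD (t : seq M) : open (W `\` [set` t]) /\ connected (W `\` [set` t]).
  have st : locally_sparse [set` t].
    apply: finite_sparse; last exact: finite_seq.
    by apply: hausdorff_accessible; exact: metric_hausdorff.
  split; last exact: sparse_complement_connected.
  by apply: openI => //; apply: closed_openC; exact: locally_sparse_closed.
have [oD1 cD1] := oD [:: a; f a].
have [|g1 [hg1 sg1 g1E]] := IH _ oD1 cD1 us.
  move=> x xs; split; first exact: hW'.
  rewrite /= !inE => /orP[]/eqP xE; move: xs; rewrite xE ?(negPf fas)// mem_cat.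
  by rewrite (negPf as_) (negPf afs).
have [oD2 cD2] := oD (s ++ map f s).
have [||g2 [hg2 sg2 g2E]] := @connected_movable _ a (f a) oD2 cD2.
- by split => //=; apply/negP; rewrite mem_cat negb_or as_ afs.
- by split => //=; exact/negP.
exists (g2 \o g1); split; first exact: homeomorphism_comp.
  apply: supported_comp.
    exact: supported_sub (@subDsetl _ _ _) sg1.
  exact: supported_sub (@subDsetl _ _ _) sg2.
move=> x; rewrite inE => /orP[/eqP ->|xs] /=.
  rewrite (supported_out sg1)// => -[_]; apply.
  by rewrite /= inE eqxx.
rewrite g1E// (supported_out sg2)// => -[_]; apply.
by rewrite /= mem_cat map_f ?orbT.
Qed.

End Surface.

(** * Ends *)

(** Monotonicity in the index lets the filter [\oo] replace a maximum over a finite subcover. *)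
Lemma compact_uniform (X : topologicalType) (Q : set X) (P : nat -> X -> Prop) :
  compact Q -> (forall m n x, (m <= n)%N -> P m x -> P n x) ->
  (forall x, Q x -> exists n, \forall y \near x, P n y) ->
  exists n, forall x, Q x -> P n x.
Proof.
move=> /compact_near_coveringP/(_ nat \oo P _) cQ Pmono Ploc.
have [x Qx|n _ hn] := cQ; last by exists n => x Qx; apply: (hn n) => /=.
have [n hn] := Ploc x Qx.
exists ([set y | P n y], [set m | (n <= m)%N]) => /=.
  by split => //; exists n.
by move=> [y m] /= [Py nm]; exact: Pmono Py.
Qed.

Section Ends.
Context (R : realType) (M : metricType R) (hman : manifold R 2 M).
Context (hconn : connected [set: M]) (K : nat -> set M) (hK : exhaustion K).
Implicit Types (x y z : M) (W : set M).

Let clK n : closed (K n).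
Proof. by apply: compact_closed; [exact: metric_hausdorff|case: hK]. Qed.

Let oCK n : open (~` K n).
Proof. exact: closed_openC. Qed.

Lemma exhaustion_mono m n : (m <= n)%N -> K m `<=` K n.
Proof.
have [_ hi _] := hK; move=> /subnKC <-; elim: (n - m)%N => [|k IH]; first by rewrite addn0.
rewrite addnS; apply: subset_trans IH _.
by apply: subset_trans (hi _) _; exact: interior_subset.
Qed.

Lemma exhaustion_ex x : exists n, K n x.
Proof. by have [_ _ hU] := hK; have : [set: M] x by []; rewrite -hU => -[n _ ?]; exists n. Qed.

Lemma exhaustion_compact (Q : set M) : compact Q -> exists n, Q `<=` K n.
Proof.
move=> cQ; apply: (compact_uniform cQ) => [m n x /exhaustion_mono|x _]; first exact.
have [n Knx] := exhaustion_ex x; have [_ hi _] := hK.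
by exists n.+1; exact: hi Knx.
Qed.

Lemma component_open W x : open W -> open (connected_component W x).
Proof.
move=> oW; rewrite openE => y xy.
have Wy := connected_component_sub xy.
have [N [[oN Ny NW] [cN _ _]]] := surface_disc hman oW Wy.
rewrite (same_connected_component xy).
apply: filterS (open_nbhs_nbhs (conj oN Ny)).
exact: connected_component_max.
Qed.

Let comp n x := connected_component (~` K n) x.
(** If [K n x] holds then [comp n x] is empty, so such an [x] counts as bounded. *)
Let bounded n x := exists m, comp n x `<=` K m.

(** A component that misses the frontier of [K n.+1] and has a point outside [K n.+1] avoids
    [K n.+1] altogether; its closure then stays outside [K n], so it is clopen in [M]. *)
Lemma component_frontier n z : ~ K n.+1 z ->
  comp n z `&` (K n.+1 `\` (K n.+1)°) !=set0 \/ comp n z = [set: M].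
Proof.
move=> Kz; have [_ hi _] := hK.
have Kz' : ~ K n z by move=> /(exhaustion_mono (leqnSn n)).
have zz : comp n z z by exact: connected_component_refl.
have [?|/set0P/negP/negPn/eqP D0] := pselect (comp n z `&` (K n.+1 `\` (K n.+1)°) !=set0); [by left|right].
have DE : comp n z `&` ~` K n.+1 = comp n z.
  apply: component_connected.
  - by exists z.
  - by exists (~` K n.+1).
  - exists (~` (K n.+1)°); first by apply: open_closedC; exact: open_interior.
    apply/seteqP; split => y [Dy h]; split => //.
      by move=> /interior_subset.
    move=> Ky; have : set0 y by rewrite -D0.
    by [].
have cD : closed (comp n z).
  have -> : comp n z = closure (comp n z); last exact: closed_closure.
  apply/seteqP; split; first exact: subset_closure.
  apply: connected_component_max; first exact: subset_closure.
  - have : closed (~` (K n.+1)°) by apply: open_closedC; exact: open_interior.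
    rewrite closure_id => cE; apply: (@subset_trans _ (~` (K n.+1)°)).
      rewrite cE; apply: closureS; rewrite -DE => y [_ h] /interior_subset; exact: h.
    by apply: subsetC; exact: hi.
  - by apply: connected_closure; exact: component_connected.
apply: hconn; first by exists z.
- by exists (comp n z); rewrite ?setTI//; exact: component_open.
- by exists (comp n z); rewrite ?setTI.
Qed.

(* A component of [~` K n] leaving [K n.+1] meets the compact frontier of [K n.+1],
   and only finitely many components do. *)
Lemma bounded_components_bounded n :
  exists m, forall z, bounded n z -> comp n z `<=` K m.
Proof.
have [cK hi _] := hK.
have [[m Km]|nK] := pselect (exists m, [set: M] `<=` K m).
  by exists m => z _; exact: subset_trans Km.
pose B := K n.+1 `\` (K n.+1)°.
have cB : compact B.
  have cI : closed (~` (K n.+1)°) by apply: open_closedC; exact: open_interior.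
  by rewrite /B setDE; apply: compact_closedI.
have [|x Bx|m hm] := @compact_uniform _ B
    (fun m x => bounded n x -> comp n x `<=` K m) cB.
- by move=> p q x /exhaustion_mono pq h /h; move/subset_trans; apply.
(* [comp n] is constant on this neighbourhood, so one bound serves all of it; if the component is
   unbounded, any index does. *)
- have nx : nbhs x (comp n x).
    apply: open_nbhs_nbhs; split; first exact: component_open.
    by apply: connected_component_refl => /hi; exact: Bx.2.
  have [[m hm]|nb] := pselect (bounded n x).
    exists m; apply: filterS nx => y /same_connected_component.
    by rewrite /bounded /comp => <- _.
  exists 0%N; apply: filterS nx => y /same_connected_component.
  by rewrite /bounded /comp => <-.
exists (maxn m n.+1) => z bz.
have [h|/existsNP[y /not_implyP[zy Ky]]] := pselect (comp n z `<=` K n.+1).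
  by apply: subset_trans h _; apply: exhaustion_mono; exact: leq_maxr.
have zE : comp n z = comp n y := same_connected_component zy.
case: (component_frontier Ky) => [[b [yb Bb]]|yT].
  have zb : comp n z = comp n b by rewrite zE; exact: same_connected_component yb.
  rewrite zb; apply: subset_trans (exhaustion_mono (leq_maxl _ _)).
  by apply: hm => //; move: bz; rewrite /bounded zb.
by exfalso; apply: nK; case: bz => p; rewrite zE yT => ?; exists p.
Qed.

(** Otherwise the components of level [n.+1] inside [comp n z] are all bounded, hence contained in a
    single [K m]; together with [K n.+1] they cover [comp n z]. *)
Lemma unbounded_step n z : ~ bounded n z ->
  exists z', ~ bounded n.+1 z' /\ comp n.+1 z' `<=` comp n z.
Proof.
move=> nb; apply: contrapT => /forallNP h; apply: nb.
have [m hm] := bounded_components_bounded n.+1.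
exists (maxn m n.+1) => y zy; have [Ky|Ky] := pselect (K n.+1 y).
  by apply: exhaustion_mono Ky; exact: leq_maxr.
have yy : comp n.+1 y y by exact: connected_component_refl.
have by_ : bounded n.+1 y.
  apply: contrapT => nb; apply: (h y); split => //.
  rewrite [X in _ `<=` X](same_connected_component zy).
  apply: connected_component_max => //; last exact: component_connected.
  apply: subset_trans (@connected_component_sub _ _ _) _.
  by apply: subsetC; exact: exhaustion_mono.
by apply: exhaustion_mono (hm _ by_ _ yy); exact: leq_maxl.
Qed.

Lemma unbounded_point n z : ~ bounded n z -> ~ K n z.
Proof.
move=> nb Kz; apply: nb; exists 0%N.
by rewrite /comp connected_component_out//; move=> h; exact: h.
Qed.

(** [unbounded_step] is iterated from level [n]; the points found also determine the levels below
    [n]. *)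
Lemma unbounded_end n z : ~ bounded n z -> exists2 Y, is_end K Y & Y n = comp n z.
Proof.
move=> nb.
have /choice[next hnext] : forall kz : nat * M, exists z', ~ bounded kz.1 kz.2 ->
    ~ bounded kz.1.+1 z' /\ comp kz.1.+1 z' `<=` comp kz.1 kz.2.
  move=> [k t] /=; have [b|b] := pselect (bounded k t); first by exists t.
  by have [z' ?] := unbounded_step b; exists z'.
(* [zs k] is a point of level [n + k]. *)
pose zs := fix zs k := if k is j.+1 then next ((n + j)%N, zs j) else z.
have ub k : ~ bounded (n + k) (zs k).
  by elim: k => [|k IH]; rewrite ?addn0// addnS; have [] := hnext (_, _) IH.
have sub k : comp (n + k.+1) (zs k.+1) `<=` comp (n + k) (zs k).
  by rewrite addnS; have [] := hnext (_, _) (ub k).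
have zz k : comp (n + k) (zs k) (zs k).
  by apply: connected_component_refl; exact: unbounded_point.
have sK k i : (i <= n + k)%N -> comp (n + k) (zs k) `<=` comp i (zs k).
  move=> ik; apply: connected_component_max => //; last exact: component_connected.
  apply: subset_trans (@connected_component_sub _ _ _) _.
  by apply: subsetC; exact: exhaustion_mono.
have nK k i : (i <= n + k)%N -> ~ K i (zs k).
  by move=> ik /(exhaustion_mono ik); exact: unbounded_point.
(* Level [i] uses [zs i], found at the deeper level [n + i]; this defines all levels uniformly,
   those below [n] included. *)
exists (fun i => comp i (zs i)); last first.
  apply/esym/same_connected_component; rewrite -/(comp n z).
  have chain k : comp (n + k) (zs k) `<=` comp n z.
    by elim: k => [|k]; [rewrite addn0|apply: subset_trans; exact: sub].
  exact: (chain n).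
split => i; first by exists (zs i) => //; apply: nK; exact: leq_addl.
have ii : comp i (zs i) (zs i.+1).
  by apply: (sK i i (leq_addl _ _)); apply: sub; exact: zz.
rewrite /comp (same_connected_component ii).
apply: connected_component_max; last exact: component_connected.
  by apply: connected_component_refl; apply: nK; exact: leq_addl.
apply: subset_trans (@connected_component_sub _ _ _) _.
by apply: subsetC; exact: exhaustion_mono.
Qed.

(** [L] is [K n] with the bounded components of its complement filled in. Each unbounded component
    extends to an end, so there is at most one, and it is then the complement of [L]; if there is
    none, [M] itself is compact. *)
Lemma one_end_hull (Q : set M) : at_most_one_end K -> compact Q ->
  exists L, [/\ compact L, Q `<=` L & connected (~` L)].
Proof.
move=> one /exhaustion_compact[n Qn]; have [cK _ _] := hK.
have [m hm] := bounded_components_bounded n.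
pose L := [set x | bounded n x].
have KL : K n `<=` L.
  by move=> x Kx; apply: contrapT => /unbounded_point.
have LK : L `<=` K (maxn n m).
  move=> x bx; have [Kx|Kx] := pselect (K n x).
    by apply: exhaustion_mono Kx; exact: leq_maxl.
  apply: (exhaustion_mono (leq_maxr _ _)); apply: (hm _ bx).
  exact: connected_component_refl.
have LE z : ~ bounded n z -> ~` L = comp n z.
  move=> nb; have [Y eY Yn] := unbounded_end nb.
  apply/seteqP; split => y /= h.
    have [Z eZ Zn] := unbounded_end h.
    rewrite -Yn (one _ _ eY eZ) Zn; apply: connected_component_refl.
    exact: unbounded_point.
  by move=> [p hp]; apply: nb; exists p; rewrite /comp (same_connected_component h).
have [[z nb]|nz] := pselect (exists z, ~ bounded n z); last first.
  have L0 : ~` L = set0.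
    by rewrite -subset0 => z h; apply: nz; exists z.
  have LT : L = K (maxn n m).
    apply/seteqP; split => // x _.
    by apply: contrapT => nb; apply: nz; exists x.
  exists L; split; [by rewrite LT|exact: subset_trans KL|rewrite L0; exact: connected0].
exists L; split.
- apply: (subclosed_compact _ (cK (maxn n m)) LK).
  by rewrite -[L]setCK (LE _ nb); apply: open_closedC; exact: component_open.
- exact: subset_trans KL.
- by rewrite (LE _ nb); exact: component_connected.
Qed.

End Ends.

(** * Extending bijections *)

(** [G n] composes the first [n] maps. On [L m] the maps of index at least [m] are the identity, so
    the sequence is stationary near each point and its limit is continuous. *)
Lemma glue_continuous (X : topologicalType) (L : nat -> set X)
    (g : nat -> X -> X) :
  (forall m n, (m <= n)%N -> L m `<=` L n) -> (forall x : X, exists n, nbhs x (L n)) ->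
  (forall n, continuous (g n)) -> (forall n, injective (g n)) ->
  (forall n x, L n x \/ ~ L n.+1 x -> g n x = x) ->
  exists2 H : X -> X, continuous H &
    forall n x, L n.+1 x -> ~ L n x -> H x = g n x.
Proof.
move=> Lmono Lcover gc ginj gid.
pose G := fix G n x := if n is k.+1 then g k (G k x) else x.
(* For [n < m], a point of [L m] sent outside [L m] would have its image fixed by [g n], hence equal
   to the point by injectivity. *)
have gL n m x : L m x -> L m (g n x).
  move=> Lx; have [nm|mn] := ltnP n m; last by rewrite gid//; left; exact: Lmono Lx.
  apply: contrapT => Lgx; apply: (Lgx); rewrite (_ : g n x = x)//; apply: (ginj n).
  by rewrite gid//; right => /(Lmono _ _ nm).
have GL n m x : L m x -> L m (G n x) by move=> Lx; elim: n => // n; exact: gL.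
have GE m k x : L m x -> G (m + k)%N x = G m x.
  move=> Lx; elim: k => [|k IH]; first by rewrite addn0.
  rewrite addnS /= gid//; left; apply: Lmono (GL _ _ _ Lx); exact: leq_addr.
have /choice[N LN] : forall x, exists n, L n x.
  by move=> x; have [n /nbhs_singleton] := Lcover x; exists n.
pose H x := G (N x) x.
have HE n x : L n x -> H x = G n x.
  move=> Lx; have [le|/ltnW le] := leqP (N x) n; rewrite /H.
    by rewrite -(subnKC le) GE.
  by rewrite -(subnKC le) GE.
exists H.
  move=> x; have [n Ln] := Lcover x; apply: (@near_eq_continuous _ _ _ (G n)).
    by apply: filterS Ln => y; exact: HE.
  elim: (n) => [|k IH]; first exact: cvg_id.
  by apply: (@continuous_comp _ _ _ (G k) (g k)); [exact: IH|exact: gc].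
move=> n x Lx nLx; rewrite (HE _ _ Lx) /=; congr (g n _).
(* The maps of index below [n] fix [x], which lies outside [L n]. *)
have : (n <= n)%N by [].
elim: {1 3}n => //= k IH kn; rewrite IH ?(ltnW kn)// gid//; right.
by move/(Lmono _ _ kn).
Qed.

(** The inverses are glued in the same way; each [g n] preserves its layer, so the two limits are
    mutually inverse layer by layer. *)
Lemma glue_homeomorphism (X : topologicalType) (L : nat -> set X)
    (g : nat -> X -> X) :
  L 0%N = set0 -> (forall m n, (m <= n)%N -> L m `<=` L n) ->
  (forall x : X, exists n, nbhs x (L n)) ->
  (forall n, homeomorphism (g n)) ->
  (forall n x, L n x \/ ~ L n.+1 x -> g n x = x) ->
  exists H : X -> X, [/\ homeomorphism H,
    forall x, exists n, H x = g n x & forall n x, g n x <> x -> H x = g n x].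
Proof.
move=> L0 Lmono Lcover gh gid.
have ginj n := homeomorphism_inj (gh n).
have /choice[g' g'P] : forall n, exists g', [/\ continuous g', cancel (g n) g' & cancel g' (g n)].
  by move=> n; have [_] := gh n.
have g'inj n : injective (g' n) by have [_ _ /can_inj] := g'P n.
have g'id n x : L n x \/ ~ L n.+1 x -> g' n x = x.
  by move=> /gid gx; have [_ gK _] := g'P n; rewrite -[in LHS]gx gK.
have [H Hc HE] := glue_continuous Lmono Lcover (fun n => (gh n).1) ginj gid.
have g'c n : continuous (g' n) by have [] := g'P n.
have [H' H'c H'E] := glue_continuous Lmono Lcover g'c g'inj g'id.
(* As [L 0] is empty, the least index of a set containing [x] is a successor. *)
have layer x : exists n, L n.+1 x /\ ~ L n x.
  have ex : exists n, `[< L n x >].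
    by have [n /nbhs_singleton ?] := Lcover x; exists n; apply/asboolP.
  case: (ex_minnP ex) => -[|n] /asboolP Lx nmin; first by rewrite L0 in Lx.
  by exists n; split => // /asboolP/nmin; rewrite ltnn.
have keep (k : nat -> X -> X) : (forall n, injective (k n)) ->
    (forall n x, L n x \/ ~ L n.+1 x -> k n x = x) ->
    forall n x, L n.+1 x -> ~ L n x -> L n.+1 (k n x) /\ ~ L n (k n x).
  move=> kinj kid n x Lx nLx.
  have fx : k n (k n x) = k n x -> k n x = x by move/kinj.
  have [E|E] := pselect (k n x = x); first by rewrite E.
  split; last by move=> h; apply: E; apply: fx; apply: kid; left.
  by apply: contrapT => h; apply: E; apply: fx; apply: kid; right.
exists H; split.
- split => //; exists H'; split => // x; have [n [Lx nLx]] := layer x.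
    have [L1 nL1] := keep _ ginj gid _ _ Lx nLx.
    by rewrite (HE _ _ Lx nLx) (H'E _ _ L1 nL1); have [_ ->] := g'P n.
  have [L1 nL1] := keep _ g'inj g'id _ _ Lx nLx.
  by rewrite (H'E _ _ Lx nLx) (HE _ _ L1 nL1); have [_ _ ->] := g'P n.
- by move=> x; have [n [Lx nLx]] := layer x; exists n; exact: HE.
- move=> n x gx; apply: HE.
    by apply: contrapT => Lx; apply: gx; apply: gid; right.
  by move=> Lx; apply: gx; apply: gid; left.
Qed.

(** * Discrete homogeneity from compact sets with connected complement *)

Section Extension.
Context (R : realType) (M : metricType R) (hman : manifold R 2 M).
Context (hconn : connected [set: M]) (K : nat -> set M) (hK : exhaustion K).
Implicit Types (x y z : M) (W L Q : set M).

Let T1 : accessible_space M.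
Proof. by apply: hausdorff_accessible; exact: metric_hausdorff. Qed.

Context (hull : forall Q, compact Q ->
  exists L, [/\ compact L, Q `<=` L & connected (~` L)]).

Section Disjoint.
Context (A : set M) (f f' : M -> M).
Context (fK : forall a, A a -> f' (f a) = a).
Context (sA : locally_sparse A) (sB : locally_sparse (f @` A)).
Context (AB : forall a b, A a -> A b -> f a <> b).

Let new L0 L a := (L a \/ L (f a)) /\ ~ (L0 a \/ L0 (f a)).

(** One stage: [L0] and [L] are consecutive sets, and [gL] provides the next map and the set
    following [L]. Absorbing [Q] makes the sets exhaust [M]. *)
Lemma extension_step L0 L Q : compact L0 -> connected (~` L0) -> compact L ->
  compact Q -> exists gL : (M -> M) * set M,
  [/\ homeomorphism gL.1, compact gL.2, connected (~` gL.2) & L `|` Q `<=` gL.2] /\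
  [/\ forall x, L0 x \/ ~ gL.2 x -> gL.1 x = x,
      forall a, A a -> new L0 L a -> gL.1 a = f a &
      forall a, A a -> ~ new L0 L a -> gL.1 a = a /\ gL.1 (f a) = f a].
Proof.
move=> cL0 nL0 cL cQ.
pose T := [set a | A a /\ new L0 L a].
have fT : finite_set T.
  apply: (@sub_finite_set _ _ ((A `&` L) `|` f' @` (f @` A `&` L))).
    move=> a [Aa [[La|Lfa] _]]; first by left.
    by right; exists (f a); [split => //; exists a|exact: fK].
  rewrite finite_setU; split; first exact: compact_sparse_finite.
  by apply: finite_image; exact: compact_sparse_finite.
have [s0 Ts0] := (finite_seqP _).1 fT.
pose s := undup s0.
have sT x : x \in s -> T x by rewrite mem_undup Ts0.
have Ts x : T x -> x \in s by rewrite Ts0 /= mem_undup.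
(* Points of [A] and of its image that are not treated at this stage are removed from [W], so
   support in [W] keeps them fixed. *)
pose W := ~` L0 `\` ((A `|` f @` A) `\` (T `|` f @` T)).
have sP : locally_sparse ((A `|` f @` A) `\` (T `|` f @` T)).
  apply: locally_sparse_sub (@subDsetl _ _ _) _; exact: locally_sparseU.
have oL0 : open (~` L0).
  by apply: closed_openC; apply: compact_closed => //; exact: metric_hausdorff.
have oW : open W.
  by apply: openI => //; apply: closed_openC; exact: locally_sparse_closed.
have cW : connected W by exact: sparse_complement_connected.
have [||g [hg sg gE]] := @connected_movable_finite _ _ hman W f s oW cW.
- rewrite cat_uniq undup_uniq map_inj_in_uniq ?undup_uniq ?andbT/=.
    apply/hasPn => _ /mapP[a /sT[Aa _] ->]; apply/negP => /sT[Afa _].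
    exact: AB Aa Afa erefl.
  by move=> a b /sT[Aa _] /sT[Ab _] fab; rewrite -(fK Aa) fab fK.
- move=> x; rewrite mem_cat => /orP[/sT Tx|/mapP[a /sT Ta ->]].
    split; last by move=> [_]; apply; left.
    by case: Tx => _ [_] nL Lx; apply: nL; left.
  split; last by move=> [_]; apply; right; exists a.
  by case: Ta => _ [_] nL Lx; apply: nL; right.
have [S cS [SW gS]] := sg.
have [L' [cL' SL' nL']] := hull (compactU (compactU cS cL) cQ).
exists (g, L'); split; split => //=.
- by move=> x [Lx|Qx]; apply: SL'; [left; right|right].
- move=> x [Lx|Lx]; first by rewrite (supported_out sg)// => -[].
  by apply: gS => Sx; apply: Lx; apply: SL'; left; left.
- by move=> a Aa na; apply: gE; apply: Ts.
- move=> a Aa na; split; apply: (supported_out sg) => -[_]; apply; split.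
  + by left.
  + move=> [[_]//|[b [Ab _] ba]]; exact: AB Ab Aa ba.
  + by right; exists a.
  + move=> [[Afa _]|[b [Ab nb] ba]]; first exact: AB Aa Afa erefl.
    by apply: na; rewrite -(fK Aa) -ba fK.
Qed.

Lemma disjoint_extension :
  exists2 h : M -> M, homeomorphism h & forall a, A a -> h a = f a.
Proof.
have [cK hi _] := hK.
have /choice[F FP] : forall p : (set M * set M) * nat, exists gL : (M -> M) * set M,
    compact p.1.1 -> connected (~` p.1.1) -> compact p.1.2 ->
    [/\ homeomorphism gL.1, compact gL.2, connected (~` gL.2) &
        p.1.2 `|` K p.2 `<=` gL.2] /\
    [/\ forall x, p.1.1 x \/ ~ gL.2 x -> gL.1 x = x,
      forall a, A a -> new p.1.1 p.1.2 a -> gL.1 a = f a &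
      forall a, A a -> ~ new p.1.1 p.1.2 a -> gL.1 a = a /\ gL.1 (f a) = f a].
  move=> [[L0 L] n] /=.
  have [[c1 [c2 c3]]|nc] := pselect (compact L0 /\ connected (~` L0) /\ compact L).
    by have [gL ?] := extension_step c1 c2 c3 (cK n); exists gL.
  by exists (id, set0) => c1 c2 c3; exfalso; apply: nc.
(* The state is the pair of [LL n] and [LL n.+1]. Both [LL 0] and [LL 1] are empty, so the even and
   the odd chain each start with the empty set. *)
pose st := fix st n : set M * set M := if n is k.+1 then
  ((st k).2, (F (st k, k)).2) else (set0, set0).
pose LL n := (st n).1; pose g n := (F (st n, n)).1.
have good n : (compact (LL n) /\ connected (~` LL n)) /\
    (compact (LL n.+1) /\ connected (~` LL n.+1)).
  elim: n => [|n [[c1 n1] [c2 n2]]].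
    by rewrite /LL /= setC0; split; split => //; exact: compact0.
  by split => //; have [[_ ? ? _] _] := FP (st n, n) c1 n1 c2.
have gP n : [/\ homeomorphism (g n), LL n.+1 `<=` LL n.+2 & K n `<=` LL n.+2] /\
    [/\ forall x, LL n x \/ ~ LL n.+2 x -> g n x = x,
      forall a, A a -> new (LL n) (LL n.+1) a -> g n a = f a &
      forall a, A a -> ~ new (LL n) (LL n.+1) a -> g n a = a /\ g n (f a) = f a].
  have [[c1 n1] [c2 n2]] := good n.
  have [[? _ _ h] h'] := FP (st n, n) c1 n1 c2; split; last exact: h'.
  split => // x ?; apply: h; last by right.
  by left.
have Lmono m n : (m <= n)%N -> LL m `<=` LL n.
  move=> /subnKC <-; elim: (n - m)%N => [|k IH]; first by rewrite addn0.
  rewrite addnS; apply: subset_trans IH _.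
  case: (m + k)%N => [|j]; first by [].
  by have [[]] := gP j.
have cover x : exists n, nbhs x (LL n).
  have [n Kn] := exhaustion_ex hK x; exists n.+3.
  have [[_ _ KL] _] := gP n.+1.
  by apply: filterS KL _; exact: hi.
(* [g i.*2] is supported between [LL i.*2] and [LL i.*2.+2], which are consecutive in the even
   chain. *)
have [|||||H0 [hH0 H0g H0E]] := @glue_homeomorphism _ (fun i => LL i.*2) (fun i => g i.*2).
- by [].
- by move=> m n mn; apply: Lmono; rewrite leq_double.
- move=> x; have [n hn] := cover x; exists n; apply: filterS hn.
  by apply: Lmono; rewrite -addnn leq_addr.
- by move=> n; have [[]] := gP n.*2.
- by move=> n x; rewrite doubleS; have [_ [h _ _]] := gP n.*2; exact: h.
have [|||||H1 [hH1 H1g H1E]] :=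
    @glue_homeomorphism _ (fun i => LL i.*2.+1) (fun i => g i.*2.+1).
- by [].
- by move=> m n mn; apply: Lmono; rewrite ltnS leq_double.
- move=> x; have [n hn] := cover x; exists n; apply: filterS hn.
  by apply: Lmono; rewrite ltnW// ltnS -addnn leq_addr.
- by move=> n; have [[]] := gP n.*2.+1.
- by move=> n x; rewrite doubleS; have [_ [h _ _]] := gP n.*2.+1; exact: h.
exists (H1 \o H0); first exact: homeomorphism_comp.
move=> a Aa.
(* The least such [n] is the stage treating [a]; no other [g k] moves [a] or [f a]. *)
have ex : exists n, `[< LL n.+1 a \/ LL n.+1 (f a) >].
  have [n /nbhs_singleton Ln] := cover a.
  by exists n; apply/asboolP; left; apply: Lmono Ln.
case: (ex_minnP ex) => n /asboolP Ln nmin.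
have nn : new (LL n) (LL n.+1) a.
  split => //; case: n Ln nmin => [_ _ []//|n Ln nmin h].
  by have := nmin n; rewrite ltnn => /(_ _)/negP; apply => //; exact/asboolP.
have other k : k != n -> g k a = a /\ g k (f a) = f a.
  move=> kn; have [_ [_ _ h]] := gP k; apply: h => //.
  move=> [Lk nLk]; move: kn; rewrite neq_ltn => /orP[kn|nk].
    by have := nmin k; rewrite leqNgt kn => /(_ _)/negP; apply => //; exact/asboolP.
  by apply: nLk; case: Ln => ?; [left|right]; apply: Lmono nk _ _.
have ga : g n a = f a by have [_ [_ h _]] := gP n; exact: h.
have fa : f a <> a by exact: AB.
have nE : n = if odd n then n./2.*2.+1 else n./2.*2.
  by rewrite -[in LHS](odd_double_half n); case: odd.
move: nE; case: ifP => on nE.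
(* For [n] odd, the even maps fix [a] and [H1] sends it to [f a]. *)
- have -> : (H1 \o H0) a = H1 a.
    rewrite /=; congr H1; have [i ->] := H0g a; apply: (other _ _).1.
    by apply/eqP => iE; move: on; rewrite -iE odd_double.
  by rewrite (H1E n./2) -nE ga.
(* For [n] even, [H0] already sends [a] to [f a], which the odd maps fix. *)
- have [j jE] := H1g (f a).
  rewrite /= (H0E n./2) -nE ga// jE; apply: (other _ _).2.
  by apply/eqP => iE; move: on; rewrite -iE /= odd_double.
Qed.

End Disjoint.

(* [c a] is chosen within a quarter of the isolation radius of [a], so that the
   [c a] cannot accumulate. *)
Lemma sparse_perturbation (A P : set M) : locally_sparse A -> locally_sparse P ->
  exists c : M -> M, [/\ forall a b, A a -> A b -> c a = c b -> a = b,
    forall a, A a -> ~ P (c a) & locally_sparse (c @` A)].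
Proof.
move=> sA sP.
have /choice[e eP] : forall a, exists e : R, 0 < e /\
    forall y, mdist a y < e -> A y -> y = a.
  move=> a; have /nbhs_ballP[e /= e0 he] : nbhs a [set y | A y -> y = a] by exact: sA.
  by exists e; split => // y ay; apply: he; rewrite ballEmdist.
have /choice[c cP] : forall a, exists y, mdist a y < e a / 4 /\ ~ P y.
  move=> a; have [e0 _] := eP a.
  have e4 : 0 < e a / 4 by rewrite divr_gt0.
  have : nbhs a (ball a (e a / 4) `&` [set y | P y -> y = a]).
    by apply: filterI; [exact: nbhsx_ballx|exact: sP].
  rewrite nbhsE => -[V [oV Va] hV].
  have [N [[_ _ NV] [_ _ [y [Ny ya]]]]] := surface_disc hman oV Va.
  have [by_ Py] := hV _ (NV _ Ny).
  by exists y; split; [move: by_; rewrite ballEmdist|move=> /Py].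
have sep a b : A a -> A b -> a <> b -> e a <= mdist a b.
  by move=> Aa Ab ab; rewrite leNgt; apply/negP => /((eP a).2 b)/(_ Ab) /esym.
have tri a b x : mdist a b <= mdist a (c a) + mdist x (c a) + mdist x (c b) + mdist b (c b).
  have h1 := metric_triangle a (c a) b.
  have h2 := metric_triangle (c a) x b.
  have h3 := metric_triangle x (c b) b.
  by move: h1 h2 h3; rewrite (metric_sym (c a) x) (metric_sym (c b) b); lra.
(* [c a] and [c b] lie within a quarter of [mdist a b] of [a] and [b], so the triangle inequality
   loses at most half of the left-hand side. *)
have near_ a b : A a -> A b -> a <> b -> forall x,
    mdist a b <= 2 * (mdist x (c a) + mdist x (c b)).
  move=> Aa Ab ab x; have h := tri a b x.
  have s1 := sep _ _ Aa Ab ab; have s2 := sep _ _ Ab Aa (nesym ab).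
  rewrite (metric_sym b a) in s2.
  have [c1 _] := cP a; have [c2 _] := cP b.
  by move: h s1 s2 c1 c2; lra.
exists c; split.
- move=> a b Aa Ab cab; apply: contrapT => ab.
  have := near_ _ _ Aa Ab ab (c a); rewrite -cab mdistxx.
  by have [e0 _] := eP a; have := sep _ _ Aa Ab ab; lra.
- by move=> a _; have [] := cP a.
- apply: discrete_subset_sparse => // x; have [e0 ex] := eP x.
  have e4 : 0 < e x / 4 by rewrite divr_gt0.
  exists (ball x (e x / 4)); first exact: nbhsx_ballx.
  move=> _ _ [_ [a Aa <-] <-] [_ [b Ab <-] <-] [y [xy yE]] [z [xz zE]].
  rewrite /= in yE zE; subst y z.
  rewrite ballEmdist /= in xy; rewrite ballEmdist /= in xz.
  apply: contrapT => nab.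
  have ab : a <> b by move=> ab; apply: nab; rewrite ab.
  (* If two distinct points of [A] had perturbations within [e x / 4] of [x], both would lie within
     [e x] of [x], hence both equal [x]. *)
  have xlt a' b' : A a' -> A b' -> a' <> b' -> mdist x (c a') < e x / 4 ->
      mdist x (c b') < e x / 4 -> a' = x.
    move=> Aa' Ab' ab' xa' xb'; apply: ex => //.
    have h1 := metric_triangle x (c a') a'; rewrite (metric_sym (c a')) in h1.
    have [h2 _] := cP a'; have h3 := sep _ _ Aa' Ab' ab'.
    by have := near_ _ _ Aa' Ab' ab' x; move: h1 h2 h3 xa' xb'; lra.
  by apply: (ab); rewrite (xlt a b)// (xlt b a)//; exact: nesym.
Qed.

(** [c] carries [A] to a discrete set disjoint from [A] and [B]. With [h1] extending [c] and [h2]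
    extending [c \o f'] from [B], the map [h2' \o h1] extends [f]. *)
Lemma hull_strongly_discrete_homogeneous : strongly_discrete_homogeneous M.
Proof.
move=> A B f /(discrete_subset_sparse T1) sA /(discrete_subset_sparse T1) sB.
move=> [fAB finj fsurj].
have finj' a b : A a -> A b -> f a = f b -> a = b.
  by move=> Aa Ab; apply: finj; rewrite inE.
have linv (g : M -> M) (D : set M) : (forall a b, D a -> D b -> g a = g b -> a = b) ->
    exists g', forall a, D a -> g' (g a) = a.
  move=> ginj; have /choice[g' g'P] : forall y, exists x, forall a, D a -> g a = y -> a = x.
    move=> y; have [[a [Da ay]]|na] := pselect (exists a, D a /\ g a = y).
      by exists a => b Db by_; apply: ginj => //; rewrite by_.
    by exists y => a Da ay; exfalso; apply: na; exists a.
  by exists g' => a Da; apply/esym; exact: g'P.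
have [f' fK] := linv f A finj'.
have [c [cinj cAB sC]] := sparse_perturbation sA (locally_sparseU sA sB).
have [c' cK] := linv c A cinj.
have [|h1 hh1 h1E] := @disjoint_extension A c c' cK sA sC.
  by move=> a b Aa Ab ab; apply: (cAB _ Aa); left; rewrite ab.
have Bf b : B b -> A (f' b) /\ f (f' b) = b.
  by move=> /fsurj[a Aa <-]; rewrite fK.
have [||||h2 hh2 h2E] := @disjoint_extension B (c \o f') (f \o c').
- by move=> b /Bf[Ab ?]; rewrite /= cK.
- by [].
- by apply: locally_sparse_sub sC => _ [b /Bf[Ab _] <-]; exists (f' b).
- move=> a b /Bf[Aa _] Bb ab; apply: (cAB _ Aa); right.
  by rewrite /= in ab; rewrite ab.
have [ch2 [h2' [ch2' h2K h2'K]]] := hh2.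
exists (h2' \o h1).
  by apply: homeomorphism_comp => //; split => //; exists h2.
move=> a Aa /=; rewrite h1E// -[in c a](fK _ Aa) -[c (f' _)]/((c \o f') (f a)).
by rewrite -h2E ?h2K//; exact: fAB.
Qed.

End Extension.

(** * Two ends *)

Lemma component_eq (X : topologicalType) (W C D E : set X) :
  is_component W C -> is_component W D -> connected E -> E `<=` W ->
  E `&` C !=set0 -> E `&` D !=set0 -> C = D.
Proof.
move=> [c Wc ->] [d Wd ->] cE EW [x [Ex cx]] [y [Ey dy]].
rewrite (same_connected_component cx) (same_connected_component dy).
exact/same_connected_component/(connected_component_max Ex EW cE).
Qed.

Lemma homogeneous_at_most_one_end (R : realType) (M : metricType R)
    (K : nat -> set M) : exhaustion K ->
  strongly_discrete_homogeneous M -> at_most_one_end K.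
Proof.
move=> hK sdh Y Z [cY dY] [cZ dZ]; have [cK hi _] := hK.
have Kmono := exhaustion_mono hK.
have mono (V : nat -> set M) : (forall n, V n.+1 `<=` V n) ->
    forall m n, (m <= n)%N -> V n `<=` V m.
  move=> dV m n /subnKC <-; elim: (n - m)%N => [|k]; first by rewrite addn0.
  by rewrite addnS; apply: subset_trans; exact: dV.
have pick (V : nat -> set M) : (forall n, is_component (~` K n) (V n)) ->
    exists p : nat -> M, forall n, V n (p n) /\ ~ K n (p n).
  move=> cV; suff /choice[p pP] : forall n, exists p, V n p /\ ~ K n p by exists p.
  by move=> n; have [p Kp ->] := cV n; exists p; split=> //; exact: connected_component_refl.
have [y yP] := pick Y cY; have [z zP] := pick Z cZ.
apply/funext => N; apply: contrapT => YZ.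
have YZ0 x : Y N x -> Z N x -> False.
  move=> Yx Zx; apply: YZ; have [p _ YE] := cY N; have [q _ ZE] := cZ N.
  rewrite YE ZE; rewrite YE in Yx; rewrite ZE in Zx.
  by rewrite (same_connected_component Yx) (same_connected_component Zx).
have /choice[next hnext] : forall n, exists m, [/\ (n < m)%N, K m (y n) & K m (z n)].
  move=> n; have [m1 h1] := exhaustion_ex hK (y n).
  have [m2 h2] := exhaustion_ex hK (z n).
  exists (maxn n.+1 (maxn m1 m2)); split; first exact: leq_maxl.
    by apply: Kmono h1; rewrite !leq_max leqnn orbT.
  by apply: Kmono h2; rewrite !leq_max leqnn !orbT.
(* The points of index [k] lie in [K (nn k.+1)] but not in [K (nn k)], so distinct indices give
   distinct points; starting at [N] keeps the two sequences in the disjoint sets [Y N] and [Z N]. *)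
pose nn k := iter k next N.
have nnS k : (nn k < nn k.+1)%N by have [] := hnext (nn k).
have nnmono k l : (k <= l)%N -> (nn k <= nn l)%N.
  move=> /subnKC <-; elim: (l - k)%N => [|j]; first by rewrite addn0.
  by rewrite addnS => /leq_trans; apply; exact: ltnW.
have nnk k : (k <= nn k)%N by elim: k => // k /leq_ltn_trans; apply.
pose w (p : nat * bool) := if p.2 then z (nn p.1) else y (nn p.1).
have wK k b : ~ K (nn k) (w (k, b)).
  by case: b; [case: (zP (nn k))|case: (yP (nn k))].
have wK' k b : K (nn k.+1) (w (k, b)).
  by have [_ h1 h2] := hnext (nn k); case: b.
have wY k : Y (nn k) (w (k, false)) by case: (yP (nn k)).
have wZ k : Z (nn k) (w (k, true)) by case: (zP (nn k)).
have winj : injective w.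
  have lt k l b c : (k < l)%N -> w (k, b) <> w (l, c).
    move=> kl E; apply: (wK l c); rewrite -E; apply: Kmono (wK' k b).
    exact: nnmono.
  move=> [k b] [l c] E; have [kl|kl|kl] := ltngtP k l.
  - by have := lt _ _ b c kl E.
  - by have := lt _ _ c b kl (esym E).
  subst l; case: b c E => -[] // E; exfalso.
    apply: (YZ0 (w (k, false))); first exact: mono dY _ _ (nnmono 0%N k isT) _ _.
    by rewrite -E; exact: mono dZ _ _ (nnmono 0%N k isT) _ _.
  apply: (YZ0 (w (k, false))); first exact: mono dY _ _ (nnmono 0%N k isT) _ _.
  by rewrite E; exact: mono dZ _ _ (nnmono 0%N k isT) _ _.
pose A := range w.
have sA : locally_sparse A.
  move=> x; have [n Kn] := exhaustion_ex hK x.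
  pose F := w @` ([set k | (k < n.+1)%N] `*` [set: bool]).
  have fF : finite_set F.
    by apply: finite_image; apply: finite_setX => //; exact: finite_II.
  have T1 : accessible_space M by apply: hausdorff_accessible; exact: metric_hausdorff.
  have nK : nbhs x (K n.+1) by exact: hi.
  (* Since [k <= nn k], only indices [k <= n] have points in [K n.+1]. *)
  apply: filterS2 nK (finite_sparse T1 fF x) => t Kt h [[k b] _ wt].
  apply: h; exists (k, b) => //; split => //=; rewrite ltnNge; apply/negP => nk.
  apply: (wK k b); rewrite wt; apply: Kmono Kt; exact: leq_trans (nnk k).
(* The flag is flipped for even indices and kept for odd ones. *)
pose s (p : nat * bool) := (p.1, odd p.1 (+) ~~ p.2).
have /choice[w' w'P] : forall x, exists p, forall q, w q = x -> p = q.
  move=> x; have [[p wp]|np] := pselect (exists p, w p = x).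
    by exists p => q wq; apply: winj; rewrite wp.
  by exists (0%N, true) => q wq; exfalso; apply: np; exists q.
have wK_ p : w' (w p) = p by exact: w'P.
have ss p : s (s p) = p.
  by case: p => k b; rewrite /s /=; congr (_, _); case: (odd k) b => -[].
pose f x := w (s (w' x)).
have fw p : f (w p) = w (s p) by rewrite /f wK_.
have dA := sparse_discrete_subset sA.
have [|h hh hE] := sdh A A f dA dA.
  split => [_ [p _ <-]|_ _ /set_mem[p _ <-] /set_mem[q _ <-]|_ [p _ <-]].
  - by rewrite fw; exists (s p).
  - by rewrite !fw => /winj/(congr1 s); rewrite !ss => ->.
  - by exists (w (s p)); [exists (s p)|rewrite fw ss].
have hw p : h (w p) = w (s p) by rewrite hE ?fw//; exists p.
have [ch [h' [ch' hK' h'K]]] := hh.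
(* With this [m], [h] sends the complement of [K m], hence [Y m], outside [K N]. *)
have [m Km] : exists m, h' @` K N `<=` K m.
  apply: exhaustion_compact => //; apply: continuous_compact => //.
  exact: continuous_subspaceT.
pose E := h @` Y m.
have cE : connected E.
  apply: connected_continuous_connected; last exact: continuous_subspaceT.
  by have [p _ ->] := cY m; exact: component_connected.
have EK : E `<=` ~` K N.
  move=> _ [t Yt <-] Kt; have [p _ YE] := cY m; rewrite YE in Yt.
  by apply: (connected_component_sub Yt); apply: Km; exists (h t).
have mE k : (m <= k)%N -> E (h (w (k, false))).
  move=> mk; exists (w (k, false)) => //; apply: mono dY _ _ _ _ (wY k).
  exact: leq_trans (nnk k).
(* The connected set [E] contains the images of the points of [Y] of indices [m.*2.+1] and [m.*2]:
   the former is fixed and lies in [Y N], the latter is exchanged and lands in [Z N]. *)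
apply: YZ; apply: (component_eq (cY N) (cZ N) cE EK).
  exists (h (w (m.*2.+1, false))); split.
    by apply: mE; rewrite ltnW// ltnS -addnn leq_addr.
  rewrite hw /s /= odd_double /=.
  exact: mono dY _ _ (nnmono 0%N _ isT) _ (wY _).
exists (h (w (m.*2, false))); split.
  by apply: mE; rewrite -addnn leq_addr.
rewrite hw /s /= odd_double /=.
exact: mono dZ _ _ (nnmono 0%N _ isT) _ (wZ _).
Qed.

Theorem corollary4p6 (R : realType) (M : metricType R)
    (hconn : connected [set: M]) (hman : manifold R 2 M)
    (K : nat -> set M) (hK : exhaustion K) :
  strongly_discrete_homogeneous M <-> at_most_one_end K.
Proof.
split; first exact: homogeneous_at_most_one_end.
move=> one; apply: (hull_strongly_discrete_homogeneous hman hconn hK) => Q.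
exact: (one_end_hull hman hconn hK).
Qed.
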